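(* Let $(\Omega,\leqslant)$ be a countable totally ordered set and assume that its automorphism group $\operatorname{Aut}(\Omega,\leqslant)$ is countable. Then $\operatorname{Aut}(\Omega,\leqslant)$ is a free abelian group of finite rank.
   Context: ''Countable'' means finite or countably infinite. $\operatorname{Aut}(\Omega,\leqslant)$ is the group of all order-preserving bijections $\Omega\to\Omega$ whose inverse is order-preserving. Finite rank includes rank $0$ (the trivial group). *)

(* Defs.v *)
From HB Require Import structures.
From mathcomp Require Import all_boot all_order all_algebra.
From mathcomp Require Import boolp classical_sets functions cardinality.

Set Implicit Arguments.
Unset Strict Implicit.
Unset Printing Implicit Defensive.

Import Order.TTheory.

Local Open Scope order_scope.

(* The inverse is stored as data; it is determined by the function, so two
   elements are equal as soon as the underlying functions agree (order_autP). *)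
Record order_aut (d : Order.disp_t) (T : orderType d) := OrderAut {
  order_aut_fun :> T -> T;
  order_aut_inv : T -> T;
  order_aut_funK : cancel order_aut_fun order_aut_inv;
  order_aut_invK : cancel order_aut_inv order_aut_fun;
  order_aut_fun_homo : {homo order_aut_fun : x y / x <= y};
  order_aut_inv_homo : {homo order_aut_inv : x y / x <= y} }.

Section OrderAutGroup.
Variables (d : Order.disp_t) (T : orderType d).
Implicit Types f g h : order_aut T.

Lemma order_autP f g : f =1 g -> f = g.
Proof.
case: f g => [f f' fK f'K hf hf'] [g g' gK g'K hg hg'] /= /funext eq_fg.
subst g; have eq_f'g' : f' = g' by apply/funext => x; rewrite -[LHS]gK f'K.
by subst g'; congr OrderAut; apply: Prop_irrelevance.
Qed.

HB.instance Definition _ := gen_eqMixin (order_aut T).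
HB.instance Definition _ := gen_choiceMixin (order_aut T).

Definition order_aut_one : order_aut T :=
  @OrderAut d T id id (fun=> erefl) (fun=> erefl)
    (fun _ _ le_xy => le_xy) (fun _ _ le_xy => le_xy).

Definition order_aut_mul f g : order_aut T :=
  @OrderAut d T (f \o g) (order_aut_inv g \o order_aut_inv f)
    (can_comp (@order_aut_funK _ _ f) (@order_aut_funK _ _ g))
    (can_comp (@order_aut_invK _ _ g) (@order_aut_invK _ _ f))
    (fun _ _ le_xy => order_aut_fun_homo f (order_aut_fun_homo g le_xy))
    (fun _ _ le_xy => order_aut_inv_homo g (order_aut_inv_homo f le_xy)).

Definition order_aut_invg f : order_aut T :=
  @OrderAut d T (order_aut_inv f) f
    (@order_aut_invK _ _ f) (@order_aut_funK _ _ f)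
    (@order_aut_inv_homo _ _ f) (@order_aut_fun_homo _ _ f).

Lemma order_aut_mulA : associative order_aut_mul.
Proof. by move=> f g h; apply: order_autP. Qed.

Lemma order_aut_mul1g : left_id order_aut_one order_aut_mul.
Proof. by move=> f; apply: order_autP. Qed.

Lemma order_aut_mulg1 : right_id order_aut_one order_aut_mul.
Proof. by move=> f; apply: order_autP. Qed.

Lemma order_aut_mulVg : left_inverse order_aut_one order_aut_invg order_aut_mul.
Proof. by move=> f; apply: order_autP => x /=; rewrite order_aut_funK. Qed.

Lemma order_aut_mulgV : right_inverse order_aut_one order_aut_invg order_aut_mul.
Proof. by move=> f; apply: order_autP => x /=; rewrite order_aut_invK. Qed.

HB.instance Definition _ := isGroup.Build (order_aut T)
  order_aut_mulA order_aut_mul1g order_aut_mulg1 order_aut_mulVg order_aut_mulgV.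

End OrderAutGroup.

Definition free_abelian_of_rank (n : nat) (G : groupType) : Prop :=
  exists phi : G -> 'rV[int]_n,
    bijective phi /\ {morph phi : x y / (x * y)%g >-> (x + y)%R}.

(* Main.v *)
Require Import Defs.
From mathcomp Require Import all_boot all_order all_algebra zify.
From mathcomp Require Import boolp classical_sets functions cardinality.

(* A countable automorphism group of a countable chain is discrete, so some
   finite set of points (a base) has trivial pointwise stabiliser.  If an orbital
   of [f] met an orbital of [g] without being equal to it, then suitable
   conjugates would produce a nontrivial automorphism whose support misses the
   base.  Hence the orbitals of all automorphisms form a finite family of
   disjoint convex sets, and the group acts on each of them freely, with
   Archimedean order.  A free dense action is impossible, since back-and-forth
   along the fibres over the completion of an orbit would yield a nontrivial
   automorphism with a fixed point.  So the action on each orbital is infinite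
   cyclic, and a minimal base has one point in each orbital. *)

Set Implicit Arguments.
Unset Strict Implicit.
Unset Printing Implicit Defensive.

Import Order.TTheory.

Local Open Scope order_scope.
Local Open Scope group_scope.

(** * Increasing chains that meet countably many requirements *)

(** Stage [n] of the chain meets the requirement of code [n], and stays put when [n] codes nothing.
    Elements carry their proof of [S], so that each stage can be extended. *)
Lemma dense_chain (P I : Type) (le : P -> P -> Prop) (S : P -> Prop)
    (E : I -> P -> Prop) (code : I -> nat) (p0 : P) :
    injective code -> (forall p, le p p) -> S p0 ->
    (forall i p, S p -> exists q, [/\ S q, le p q & E i q]) ->
  exists c : nat -> P,
    [/\ c 0%N = p0, forall n, S (c n), forall n, le (c n) (c n.+1) &
        forall i, exists n, E i (c n)].
Proof.
move=> code_inj le_refl Sp0 extend.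
have step n (p : {p | S p}) : exists q : {p | S p},
    le (sval p) (sval q) /\ forall i, code i = n -> E i (sval q).
  case: p => p Sp /=; have [[i code_i]|no_i] := pselect (exists i, code i = n).
    have [q [Sq le_pq Eq]] := extend i p Sp; exists (exist _ q Sq); split=> // j.
    by rewrite -code_i => /code_inj ->.
  by exists (exist _ p Sp); split=> // j code_j; case: no_i; exists j.
pose next n p := sval (cid (step n p)).
pose fix chain n := if n is m.+1 then next m (chain m) else exist _ p0 Sp0.
exists (fun n => sval (chain n)); split=> // [n|n|i].
- exact: svalP (chain n).
- by have [] := svalP (cid (step n (chain n))).
- by exists (code i).+1; have [_] := svalP (cid (step (code i) (chain (code i)))); apply.
Qed.

(** * Back-and-forth and bases *)

Section Automorphisms.
Variables (d : Order.disp_t) (T : orderType d).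
Implicit Types (f g h : order_aut T) (x y z : T).

Lemma order_autM f g x : (f * g) x = f (g x). Proof. by []. Qed.
Lemma order_autK g x : g^-1 (g x) = x. Proof. exact: order_aut_funK. Qed.
Lemma order_autVK g x : g (g^-1 x) = x. Proof. exact: order_aut_invK. Qed.

Lemma order_aut_le g x y : (g x <= g y) = (x <= y).
Proof.
apply/idP/idP; last exact: order_aut_fun_homo.
by move=> /(order_aut_fun_homo g^-1); rewrite !order_autK.
Qed.

Lemma order_aut_lt g x y : (g x < g y) = (x < y).
Proof. by rewrite !ltNge order_aut_le. Qed.

Lemma order_aut_inj g : injective g.
Proof. exact: can_inj (order_autK g). Qed.

Lemma order_aut_fixV g x : g x = x -> g^-1 x = x.
Proof. by move=> gx; rewrite -[in LHS]gx order_autK. Qed.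

Lemma order_aut_moves g : g <> 1 -> exists x, g x <> x.
Proof.
by move=> g1; apply: contrapT => no_x; apply: g1; apply: order_autP => x;
   apply: contrapT => gx; apply: no_x; exists x.
Qed.

Definition subrel_prop (p q : T -> T -> Prop) := forall x y, p x y -> q x y.

Definition monotone_rel (p : T -> T -> Prop) :=
  forall x y x' y', p x y -> p x' y' -> (x <= x') = (y <= y').

(** Totality, surjectivity and the extra requirements [E n] are all met along one chain of
    admissible relations. The union of the chain is monotone, and antisymmetry of the order then
    makes it functional and injective. *)
Lemma back_and_forth (S : (T -> T -> Prop) -> Prop)
    (E : nat -> (T -> T -> Prop) -> Prop) (p0 : T -> T -> Prop) :
    countable [set: T] -> S p0 ->
    (forall p, S p -> monotone_rel p) ->
    (forall p x, S p -> exists q, [/\ S q, subrel_prop p q & exists y, q x y]) ->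
    (forall p y, S p -> exists q, [/\ S q, subrel_prop p q & exists x, q x y]) ->
    (forall n p, S p -> exists q, [/\ S q, subrel_prop p q & E n q]) ->
  exists h : order_aut T,
    (forall x y, p0 x y -> h x = y) /\
    (forall n, exists2 q, E n q & forall x y, q x y -> h x = y).
Proof.
move=> /countable_injP[code /in2TT code_inj] Sp0 mono forth back extE.
pose D (i : T + T + nat) (q : T -> T -> Prop) : Prop :=
  match i with
  | inl (inl x) => exists y, q x y
  | inl (inr y) => exists x, q x y
  | inr n => E n q
  end.
pose codeI (i : T + T + nat) : nat :=
  pickle (match i with
  | inl (inl x) => inl (inl (code x))
  | inl (inr y) => inl (inr (code y))
  | inr n => inr n
  end : nat + nat + nat).
have codeI_inj : injective codeI.
  move=> i j /(pcan_inj pickleK).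
  by case: i => [[]|] i; case: j => [[]|] j // []; try move/code_inj; move=> ->.
have D_dense i p : S p -> exists q, [/\ S q, subrel_prop p q & D i q].
  by case: i => [[x|y]|n]; [apply: forth | apply: back | apply: extE].
have [c [c0 Sc c_le cD]] := dense_chain codeI_inj (fun p x y pxy => pxy) Sp0 D_dense.
have c_mono m n : (m <= n)%N -> subrel_prop (c m) (c n).
  move=> /subnK <-; elim: (n - m)%N => // k IHk x y cxy.
  exact/c_le/IHk.
pose R x y := exists n, c n x y.
have R_mono : monotone_rel R.
  move=> x y x' y' [m cxy] [n cxy']; apply: (mono _ (Sc (maxn m n))).
    exact: c_mono (leq_maxl _ _) _ _ cxy.
  exact: c_mono (leq_maxr _ _) _ _ cxy'.
have R_fun x : exists y, R x y.
  by have [n [y cxy]] := cD (inl (inl x)); exists y, n.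
have R_inv y : exists x, R x y.
  by have [n [x cxy]] := cD (inl (inr y)); exists x, n.
pose h x := sval (cid (R_fun x)); pose h' y := sval (cid (R_inv y)).
have hR x : R x (h x) := svalP (cid (R_fun x)).
have h'R y : R (h' y) y := svalP (cid (R_inv y)).
have R_inj x x' y : R x y -> R x' y -> x = x'.
  by move=> Rx Rx'; apply/eqP; rewrite eq_le (R_mono _ _ _ _ Rx Rx')
     (R_mono _ _ _ _ Rx' Rx) lexx.
have R_funct x y y' : R x y -> R x y' -> y = y'.
  by move=> Rx Rx'; apply/eqP; rewrite eq_le -(R_mono _ _ _ _ Rx Rx')
     -(R_mono _ _ _ _ Rx' Rx) lexx.
have hK : cancel h h' by move=> x; apply: R_inj (h'R _) (hR _).
have h'K : cancel h' h by move=> x; apply: R_funct (hR _) (h'R _).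
have h_homo : {homo h : x y / x <= y}.
  by move=> x y; rewrite (R_mono _ _ _ _ (hR x) (hR y)).
have h'_homo : {homo h' : x y / x <= y}.
  by move=> x y; rewrite (R_mono _ _ _ _ (h'R x) (h'R y)).
exists (OrderAut hK h'K h_homo h'_homo); split=> /= [x y p0xy|n].
  by apply: R_funct (hR x) _; exists 0%N; rewrite c0.
have [m Em] := cD (inr n); exists (c m) => // x y cxy.
by apply: R_funct (hR x) _; exists m.
Qed.

(* A countable closed permutation group is discrete: otherwise a back-and-forth
   diagonalises against an enumeration of the group. *)
Lemma finite_base :
    countable [set: T] -> countable [set: order_aut T] ->
  exists F : seq T, forall g, {in F, forall x, g x = x} -> g = 1.
Proof.
move=> cT /countable_injP[code /in2TT code_inj].
apply: contrapT => no_base.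
have nontriv (F : seq T) : exists2 g : order_aut T, {in F, forall x, g x = x} & g <> 1.
  apply: contrapT => F_base; apply: no_base; exists F => g gF.
  by apply: contrapT => g1; apply: F_base; exists g.
pose graph (h : order_aut T) (F : seq T) x y := x \in F /\ y = h x.
pose S p := exists h F, p = graph h F.
(* Requirement [n] forces disagreement with the automorphism of code [n]. *)
pose E n (p : T -> T -> Prop) := forall g, code g = n -> exists x y, p x y /\ g x <> y.
have ext h F x : subrel_prop (graph h F) (graph h (x :: F)).
  by move=> a b [aF ->]; split; rewrite // inE aF orbT.
have [|||||h [_ hE]] := @back_and_forth S E (graph 1 [::]) cT _ _ _ _ _.
- by exists 1, [::].
- by move=> _ [h [F ->]] x y x' y' [_ ->] [_ ->]; rewrite order_aut_le.
- move=> _ x [h [F ->]]; exists (graph h (x :: F)); split; first by exists h, (x :: F).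
    exact: ext.
  by exists (h x); split; rewrite ?inE ?eqxx.
- move=> _ y [h [F ->]]; exists (graph h (h^-1 y :: F)); split.
  + by exists h, (h^-1 y :: F).
  + exact: ext.
  + by exists (h^-1 y); split; rewrite ?inE ?eqxx // order_autVK.
- move=> n _ [h [F ->]].
  have [[g code_g]|no_g] := pselect (exists g, code g = n); last first.
    exists (graph h F); split=> //; first by exists h, F.
    by move=> g code_g; case: no_g; exists g.
  (* If [h] is [g] itself, a nontrivial [s] fixing [F] gives [h * s], which agrees with [h] on [F]
     but differs from [g]. *)
  have [h' hF h'g] : exists2 h' : order_aut T,
      {in F, forall x, h x = h' x} & g^-1 * h' <> 1.
    have [gh|] := pselect (g^-1 * h = 1); last by exists h.
    have [s sF s1] := nontriv F; exists (h * s); last by rewrite mulgA gh mul1g.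
    by move=> x xF; rewrite order_autM sF.
  have [x h'x] := order_aut_moves h'g.
  exists (graph h' (x :: F)); split; first by exists h', (x :: F).
    by move=> a b [aF ->]; rewrite hF //; apply: ext.
  move=> g'; rewrite -code_g => /code_inj ->; exists x, (h' x); split.
    by split; rewrite ?inE ?eqxx.
  by move=> gx; apply: h'x; rewrite order_autM -gx order_autK.
(* The limit [h] has a code too, hence disagrees with itself somewhere. *)
- have [q /(_ h erefl)[x [y [qxy hxy]]] h_ext] := hE (code h).
  exact/hxy/h_ext.
Qed.

End Automorphisms.

(** * Orbitals *)

Section Orbitals.
Variables (d : Order.disp_t) (T : orderType d).
Implicit Types (b f g h k : order_aut T) (x y z : T).

Definition invariant_lower g (C : T -> Prop) :=
  (forall y z, y <= z -> C z -> C y) /\ (forall z, C (g z) <-> C z).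

(* The convex hull of the cycle of [x] under [g]: no invariant cut separates
   two of its points. *)
Record orbital g x y : Prop := Orbital {
  orbital_cut :> forall C, invariant_lower g C -> (C x <-> C y) }.

Lemma orbital_refl g x : orbital g x x. Proof. by []. Qed.

Lemma orbital_sym g x y : orbital g x y -> orbital g y x.
Proof. by move=> Oxy; split=> C C_inv; rewrite (Oxy C C_inv). Qed.

Lemma orbital_trans g x y z : orbital g x y -> orbital g y z -> orbital g x z.
Proof. by move=> Oxy Oyz; split=> C C_inv; rewrite (Oxy C C_inv); apply: Oyz. Qed.

Lemma orbital_app g x : orbital g x (g x).
Proof. by split=> C [_ Cg]; rewrite Cg. Qed.

Lemma orbital_appE g x y : orbital g x (g y) <-> orbital g x y.
Proof.
split=> Oxy; first exact: orbital_trans Oxy (orbital_sym (orbital_app _ _)).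
exact: orbital_trans Oxy (orbital_app _ _).
Qed.

Lemma orbital_expgE g x y n : orbital g x ((g ^+ n) y) <-> orbital g x y.
Proof. by elim: n => [|n IHn] //; rewrite expgS order_autM orbital_appE. Qed.

Lemma orbital_convex g x y z w :
  orbital g x y -> orbital g x z -> y <= w -> w <= z -> orbital g x w.
Proof.
move=> Oxy Oxz le_yw le_wz; split=> C C_inv; have [Clow _] := C_inv.
by split=> [/(Oxz C C_inv)|/(Clow _ _ le_yw)/(Oxy C C_inv)//]; apply: Clow.
Qed.

Lemma orbitalV g x y : orbital g^-1 x y <-> orbital g x y.
Proof.
suff imp h : orbital h x y -> orbital h^-1 x y.
  by split=> [/imp|]; rewrite ?invgK //; apply: imp.
move=> Oxy; split=> C [Clow Ch]; apply: Oxy; split=> // z.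
by rewrite -(Ch (h z)) order_autK.
Qed.

Lemma orbitalJ g h x y : orbital (h * g * h^-1) (h x) (h y) <-> orbital g x y.
Proof.
have imp k f u v : orbital f u v -> orbital (k * f * k^-1) (k u) (k v).
  move=> Ouv; split=> C [Clow Cinv]; apply: (Ouv (C \o k)); split=> /= [a b le_ab|a].
    by apply: Clow; rewrite order_aut_le.
  by rewrite -[C (k a)]Cinv !order_autM order_autK.
split=> [/(imp h^-1)|]; last exact: imp.
by rewrite !order_autK invgK !mulgA mulVg mul1g mulgVK.
Qed.

(** Both cuts at a fixed point are invariant, and together they isolate it. *)
Lemma orbital_fix g x y : g x = x -> orbital g x y -> y = x.
Proof.
move=> gx Oxy; apply/eqP; rewrite eq_le; apply/andP; split.
  have [|le_xx _] := Oxy (fun z => z <= x); last exact: le_xx.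
  by split=> [u v le_uv|z]; [apply: le_trans | rewrite -[in g z <= x]gx order_aut_le].
rewrite leNgt; apply/negP => lt_yx.
have [|_ /(_ lt_yx)] := Oxy (fun z => z < x); last by rewrite ltxx.
by split=> [u v le_uv|z]; [apply: le_lt_trans | rewrite -[in g z < x]gx order_aut_lt].
Qed.

Lemma orbital_moved g x y : orbital g x y -> g x <> x -> g y <> y.
Proof.
move=> Oxy gx gy; apply: gx.
by rewrite (orbital_fix gy (orbital_sym Oxy)).
Qed.

Lemma expg_up g x m n :
  x <= g x -> (m <= n)%N -> (g ^+ m) x <= (g ^+ n) x.
Proof.
move=> gx /subnK <-; elim: (n - m)%N => // k IHk.
apply: le_trans IHk _; rewrite addSn expgSr order_autM order_aut_le //.
Qed.

Lemma expg_down g x n : g x <= x -> (g ^+ n) x <= x.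
Proof.
move=> gx; elim: n => // n IHn.
by rewrite expgS order_autM; apply: le_trans gx; rewrite order_aut_le.
Qed.

(** The points below some [(g ^+ n) x] form an invariant lower set containing [x]. *)
Lemma orbital_archimedean g x y :
  x < g x -> orbital g x y -> exists n, y < (g ^+ n) x.
Proof.
move=> gx Oxy.
suff C_inv : invariant_lower g (fun z => exists n, z < (g ^+ n) x).
  by have [C_xy _] := Oxy _ C_inv; apply: C_xy; exists 1%N.
split=> [u v le_uv [n lt_vn]|z]; first by exists n; apply: le_lt_trans lt_vn.
split=> [[n lt_n]|[n lt_n]]; last first.
  by exists n.+1; rewrite expgS order_autM order_aut_lt.
exists n; rewrite -(order_aut_lt g) -order_autM -expgS.
by apply: lt_le_trans lt_n _; apply: expg_up (ltW gx) (leqnSn n).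
Qed.

Lemma orbital_up g x y : x < g x -> orbital g x y -> y < g y.
Proof.
move=> gx Oxy; rewrite ltNge; apply/negP => gy.
have [m lt_m] := orbital_archimedean gx Oxy.
(* This cut contains [y], hence [x], so some [(g ^+ n) x] is at most [y]. As [g] does not raise [y],
   neither does [g ^+ m] raise [(g ^+ n) x] above [y], although [y < (g ^+ m) x]. *)
have C_inv : invariant_lower g (fun z => exists n, (g ^+ n) z <= y).
  split=> [u v le_uv [n le_n]|z].
    by exists n; apply: le_trans le_n; rewrite order_aut_le.
  split=> [[n le_n]|[n le_n]]; first by exists n.+1; rewrite expgSr order_autM.
  exists n; rewrite -order_autM -expgSr expgS order_autM.
  by apply: le_trans gy; rewrite order_aut_le.
have [_ [|n le_n]] := Oxy _ C_inv; first by exists 0%N.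
move: lt_m; rewrite ltNge => /negP; apply.
apply: (@le_trans _ _ ((g ^+ (m + n)) x)).
  by apply: expg_up (leq_addr _ _); apply: ltW.
rewrite expgnDr order_autM; apply: le_trans (expg_down m gy).
by rewrite order_aut_le.
Qed.

(** An automorphism and its inverse have the same orbitals, so the direction of motion at one point
    may be chosen freely. *)
Lemma moved_up g x : g x <> x ->
  exists2 k : order_aut T, x < k x & forall u v, orbital k u v <-> orbital g u v.
Proof.
move=> gx; have [lt_x|lt_gx|eq_x] := ltgtP x (g x); last by case: gx.
  by exists g.
exists g^-1; last exact: orbitalV.
by rewrite -(order_aut_lt g) order_autVK.
Qed.

Lemma moved_down g x : g x <> x ->
  exists2 k : order_aut T, k x < x & forall u v, orbital k u v <-> orbital g u v.
Proof.
move=> /moved_up[k lt_x Ok]; exists k^-1; first by rewrite -(order_aut_lt k) order_autVK.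
by move=> u v; rewrite orbitalV.
Qed.

Lemma orbital_down g x y : g x < x -> orbital g x y -> g y < y.
Proof.
move=> gx /orbitalV Oxy; rewrite -(order_aut_lt g^-1) order_autK.
by apply: orbital_up Oxy; rewrite -(order_aut_lt g) order_autVK.
Qed.

Lemma orbital_archimedean_down g x y :
  g x < x -> orbital g x y -> exists n, (g ^+ n) x < y.
Proof.
move=> gx Oxy; have gy := orbital_down gx Oxy.
have Vy : y < g^-1 y by rewrite -(order_aut_lt g) order_autVK.
have Oyx : orbital g^-1 y x by rewrite orbitalV; apply: orbital_sym.
have [n lt_n] := orbital_archimedean Vy Oyx.
by exists n; rewrite -(order_aut_lt (g ^+ n)^-1) order_autK -expVgn.
Qed.

(** * Restriction of an automorphism to one of its orbitals *)

Definition orbital_part_fun g x y := if `[< orbital g x y >] then g y else y.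

Lemma orbital_part_fun_homo g x : {homo orbital_part_fun g x : y z / y <= z}.
Proof.
move=> y z le_yz; rewrite /orbital_part_fun.
case: asboolP => Oy; case: asboolP => Oz //; first by rewrite order_aut_le.
(* A point between [y] and [g y] would lie in the orbital by convexity; the other mixed case is
   alike. *)
- rewrite leNgt; apply/negP => lt_z; apply: Oz.
  by apply: orbital_convex le_yz (ltW lt_z); rewrite ?orbital_appE.
- rewrite leNgt; apply/negP => lt_y; apply: Oy.
  by apply: orbital_convex (ltW lt_y) le_yz; rewrite ?orbital_appE.
Qed.

Lemma orbital_part_funK g x : cancel (orbital_part_fun g x) (orbital_part_fun g^-1 x).
Proof.
move=> y; rewrite /orbital_part_fun.
case: (asboolP (orbital g x y)) => Oy; case: asboolP; rewrite orbitalV ?orbital_appE //.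
by move=> _; rewrite order_autK.
Qed.

Lemma orbital_part_funVK g x : cancel (orbital_part_fun g^-1 x) (orbital_part_fun g x).
Proof. by move=> y; rewrite -{1}[g]invgK orbital_part_funK. Qed.

Definition orbital_part g x : order_aut T :=
  OrderAut (@orbital_part_funK g x) (@orbital_part_funVK g x)
    (@orbital_part_fun_homo g x) (@orbital_part_fun_homo g^-1 x).

Lemma orbital_part_in g x y : orbital g x y -> orbital_part g x y = g y.
Proof. by rewrite /= /orbital_part_fun => Oxy; case: asboolP. Qed.

Lemma orbital_part_out g x y : ~ orbital g x y -> orbital_part g x y = y.
Proof. by rewrite /= /orbital_part_fun => Oxy; case: asboolP. Qed.

Lemma expg_orbital_part g x n : (orbital_part g x ^+ n) x = (g ^+ n) x.
Proof.
elim: n => // n IHn; rewrite !expgS order_autM IHn orbital_part_in //.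
by rewrite orbital_expgE.
Qed.

(** * Orbitals in the presence of a finite base *)

Section Base.
Variables (F : seq T).
Hypothesis F_base : forall g, {in F, forall x, g x = x} -> g = 1.

(* Conjugating [orbital_part f z] by powers of [g] would push its support off the base. *)
Lemma orbital_nested f g z y : f z <> z ->
  (forall u, orbital f z u -> orbital g z u) -> orbital g z y -> orbital f z y.
Proof.
move=> fz sub_fg gzy; apply: contrapT => fzy.
have gz : g z <> z.
  by move=> gz; apply: fz; apply: orbital_fix gz _; apply/sub_fg/orbital_app.
(* By convexity the orbital of [f] at [z] does not reach [y]. Take for [k] whichever of [g] and its
   inverse moves [z] towards [y]: its powers push each point of the orbital of [g] past [y], and
   keep the other points outside that orbital. *)
have [k k_push] : exists k : order_aut T, forall w,
    exists N, forall n, (N <= n)%N -> ~ orbital f z ((k ^+ n) w).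
  have [lt_zy|lt_yz|eq_zy] := ltgtP z y; last by case: fzy; rewrite -eq_zy.
  - have [k kz Ok] := moved_up gz; exists k => w.
    have [zw|zw] := pselect (orbital k z w); last first.
      by exists 0%N => n _ /sub_fg /Ok /orbital_expgE.
    have kw := orbital_up kz zw.
    have [|N lt_N] := orbital_archimedean kw (y := y).
      by apply: orbital_trans (orbital_sym zw) _; apply/Ok.
    exists N => n le_Nn fzn; apply: fzy.
    apply: orbital_convex (orbital_refl _ _) fzn (ltW lt_zy) _.
    by apply: le_trans (ltW lt_N) _; apply: expg_up (ltW kw) le_Nn.
  - have [k kz Ok] := moved_down gz; exists k => w.
    have [zw|zw] := pselect (orbital k z w); last first.
      by exists 0%N => n _ /sub_fg /Ok /orbital_expgE.
    have kw := orbital_down kz zw.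
    have [|N lt_N] := orbital_archimedean_down kw (y := y).
      by apply: orbital_trans (orbital_sym zw) _; apply/Ok.
    exists N => n le_Nn fzn; apply: fzy.
    apply: orbital_convex fzn (orbital_refl _ _) _ (ltW lt_yz).
    apply: le_trans (ltW lt_N); rewrite -(subnK le_Nn) addnC expgnDr order_autM.
    by rewrite order_aut_le expg_down // ltW.
(* Finiteness of the base makes one exponent work for all its points. *)
have [n Fn] : exists n, {in F, forall w, ~ orbital f z ((k ^+ n) w)}.
  suff [N FN] : exists N, {in F, forall w, forall n, (N <= n)%N ->
      ~ orbital f z ((k ^+ n) w)} by exists N => w /FN; apply.
  elim: (F) => [|a s [N sN]]; first by exists 0%N.
  have [M aM] := k_push a; exists (maxn M N) => w.
  rewrite inE => /predU1P[->|/sN w_n] n; rewrite geq_max => /andP[leM leN].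
    exact: aM.
  exact: w_n.
have conj1 : (k ^+ n)^-1 * orbital_part f z * k ^+ n = 1.
  by apply: F_base => w /Fn w_n; rewrite !order_autM orbital_part_out // order_autK.
have part1 : orbital_part f z = 1.
  have /(congr1 (fun b => k ^+ n * b * (k ^+ n)^-1)) := conj1.
  by rewrite !mulgA mulgV mul1g mulgK mulg1 mulgV.
by apply: fz; rewrite -(orbital_part_in (orbital_refl f z)) part1.
Qed.

(** The image under [b] of the orbital of [f] at [z] is an orbital of [b * f * b^-1]. By hypothesis
    it contains the orbital of [f], and [orbital_nested] makes the two equal. *)
Lemma orbital_absorb f b z : f z <> z ->
  (forall u, orbital f z u -> orbital f z (b^-1 u)) ->
  forall u, orbital f z u -> orbital f z (b u).
Proof.
move=> fz bV u fzu; pose f' := b * f * b^-1.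
have f'bz : orbital f' (b z) z.
  by rewrite -[X in orbital _ _ X](order_autVK b) orbitalJ; apply: bV.
apply: (orbital_nested (g := f') fz) => [v fzv|].
  apply: orbital_trans (orbital_sym f'bz) _.
  by rewrite -[v](order_autVK b) orbitalJ; apply: bV.
by apply: orbital_trans (orbital_sym f'bz) _; rewrite orbitalJ.
Qed.

(** By symmetry, two nontrivial orbitals that meet are equal. Inclusion is settled by
    [orbital_nested]; what remains is that each has a point outside the other, on opposite sides of
    [z]. *)
Lemma sub_orbital f g z y :
  f z <> z -> g z <> z -> orbital g z y -> orbital f z y.
Proof.
move=> fz gz gzy; apply: contrapT => fzy.
have [w fzw gzw] : exists2 w, orbital f z w & ~ orbital g z w.
  apply: contrapT => sub; apply/fzy/(orbital_nested fz _ gzy) => u fzu.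
  by apply: contrapT => gzu; apply: sub; exists u.
(* If [k^-1] keeps the overlap inside the orbital of [f], then [orbital_part k z] preserves that
   orbital by [orbital_absorb], so all powers of [k] keep [z] in it. *)
have push (k : order_aut T) : (forall u v, orbital k u v <-> orbital g u v) ->
    (forall u, orbital f z u -> orbital k z u -> orbital f z (k^-1 u)) ->
  forall n, orbital f z ((k ^+ n) z).
  move=> Ok kV; suff b_abs u : orbital f z u -> orbital f z (orbital_part k z u).
    elim=> [|n IHn] //; rewrite -expg_orbital_part expgS order_autM.
    by apply: b_abs; rewrite expg_orbital_part.
  apply: orbital_absorb => // {}u fzu.
  have [kzu|kzu] := pselect (orbital k z u); last first.
    by rewrite order_aut_fixV // orbital_part_out.
  have kzVu : orbital k z (k^-1 u) by rewrite -orbital_appE order_autVK.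
  rewrite -[u in (orbital_part _ _)^-1 u](order_autVK k) -(orbital_part_in kzVu).
  by rewrite order_autK; apply: kV.
have [lt_zy|lt_yz|eq_zy] := ltgtP z y; last by case: fzy; rewrite -eq_zy.
- have lt_wz : w < z.
    rewrite ltNge; apply/negP => le_zw; have [le_wy|/ltW le_yw] := leP w y.
      by apply: gzw; apply: orbital_convex gzy le_zw le_wy.
    by apply: fzy; apply: orbital_convex fzw (ltW lt_zy) le_yw.
  have [k kz Ok] := moved_up gz.
  have [|n lt_n] := orbital_archimedean kz (y := y); first exact/Ok.
  apply: fzy; apply: orbital_convex (push k Ok _ n) (ltW lt_zy) (ltW lt_n) => //.
  (* The point [k^-1 u] lies below [u], and above [w] because [w] is below the whole orbital of
     [k]. *)
  move=> u fzu kzu; have kzVu : orbital k z (k^-1 u) by rewrite -orbital_appE order_autVK.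
  apply: (orbital_convex fzw fzu).
    rewrite leNgt; apply/negP => lt_w; apply/gzw/Ok.
    exact: orbital_convex kzVu (orbital_refl _ _) (ltW lt_w) (ltW lt_wz).
  by rewrite -(order_aut_le k) order_autVK ltW // (orbital_up kz).
- have lt_zw : z < w.
    rewrite ltNge; apply/negP => le_wz; have [le_yw|/ltW le_wy] := leP y w.
      by apply: gzw; apply: orbital_convex gzy (orbital_refl _ _) le_yw le_wz.
    by apply: fzy; apply: orbital_convex fzw (orbital_refl _ _) le_wy (ltW lt_yz).
  have [k kz Ok] := moved_down gz.
  have [|n lt_n] := orbital_archimedean_down kz (y := y); first exact/Ok.
  apply: fzy; move: (ltW lt_n) (ltW lt_yz).
  apply: orbital_convex (push k Ok _ n) (orbital_refl _ _).
  move=> u fzu kzu; have kzVu : orbital k z (k^-1 u) by rewrite -orbital_appE order_autVK.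
  apply: (orbital_convex fzu fzw).
    by rewrite -(order_aut_le k) order_autVK ltW // (orbital_down kz).
  rewrite leNgt; apply/negP => lt_w; apply/gzw/Ok.
  exact: orbital_convex (orbital_refl _ _) kzVu (ltW lt_zw) (ltW lt_w).
Qed.

(** This is freeness of the action on an orbital: if [h] moved [y], its orbital at [y] would contain
    the fixed point [x]. *)
Lemma fix_orbital h x y g : g x <> x -> orbital g x y -> h x = x -> h y = y.
Proof.
move=> gx Oxy hx; apply: contrapT => hy; have gy := orbital_moved Oxy gx.
apply: (hy); rewrite (orbital_fix hx (y := y)) //.
exact/orbital_sym/(sub_orbital hy gy)/orbital_sym.
Qed.

Lemma orbital_any h g x : g x <> x -> orbital g x (h x).
Proof.
move=> gx; have [->//|/eqP hx] := eqVneq (h x) x.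
exact: sub_orbital gx hx (orbital_app _ _).
Qed.

(** The direction of [h^-1 * h'] is constant on its orbital at [x], which contains that of [g]. Thus
    automorphisms are compared on a whole orbital by their values at one point. *)
Lemma lt_orbital h h' g x y :
  g x <> x -> orbital g x y -> h x < h' x -> h y < h' y.
Proof.
move=> gx Oxy lt_x; pose k := h^-1 * h'.
have kx : x < k x by rewrite -(order_aut_lt h) order_autM order_autVK.
rewrite -(order_aut_lt h^-1) order_autK; apply: (orbital_up kx).
by apply: sub_orbital Oxy => // k_x; move: kx; rewrite k_x ltxx.
Qed.

End Base.

End Orbitals.

(** * Dense orbits *)

(** The interval from [x] to [f x] is a fundamental domain. The exponent [m] lifts [y] above [x],
    and [k.+1] is the least exponent that takes [x] beyond the lifted point. *)
Lemma orbital_domain (d : Order.disp_t) (T : orderType d) (f : order_aut T) (x y : T) :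
    x < f x -> orbital f x y ->
  exists m k, x <= (f ^+ k)^-1 ((f ^+ m) y) < f x.
Proof.
move=> fx Oxy.
have [m lt_m] := orbital_archimedean (orbital_up fx Oxy) (orbital_sym Oxy).
have /(orbital_archimedean fx) ex_n : orbital f x ((f ^+ m) y) by rewrite orbital_expgE.
case: (ex_minnP ex_n) => -[|k] lt_k min_k; first by move: lt_m; rewrite ltNge ltW.
exists m, k; rewrite -(order_aut_lt (f ^+ k)) -(order_aut_le (f ^+ k)) order_autVK.
rewrite -[(f ^+ k) (f x)]order_autM -expgSr lt_k andbT leNgt.
by apply/negP => /min_k; rewrite ltnn.
Qed.

Lemma seq_max (d : Order.disp_t) (T : orderType d) (s : seq T) :
  s = [::] \/ exists2 m, m \in s & {in s, forall x, x <= m}.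
Proof.
case: s => [|a s]; [by left | right; elim: s a => [|b s IHs] a].
  by exists a; rewrite ?inE // => x; rewrite inE => /eqP->.
have [m ms m_max] := IHs b; have [le_am|lt_ma] := leP a m.
  exists m => [|x]; first by rewrite inE ms orbT.
  by rewrite inE => /predU1P[->|/m_max].
exists a => [|x]; first by rewrite inE eqxx.
by rewrite inE => /predU1P[->|/m_max le_xm] //; apply: le_trans le_xm (ltW lt_ma).
Qed.

Lemma seq_min (d : Order.disp_t) (T : orderType d) (s : seq T) :
  s = [::] \/ exists2 m, m \in s & {in s, forall x, m <= x}.
Proof. exact: (@seq_max _ T^d s). Qed.

(** * An orbital without a least upward translation, to be refuted *)

Section DenseOrbital.
Variables (d : Order.disp_t) (T : orderType d) (F : seq T).
Implicit Types (f g h k t : order_aut T) (x y z u v : T).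
Hypothesis F_base : forall g, {in F, forall x, g x = x} -> g = 1.
Hypothesis countable_T : countable [set: T].
Variables (g0 : order_aut T) (x0 : T).
Hypothesis g0x0 : g0 x0 <> x0.

Local Notation J := (orbital g0 x0).

Lemma J_app h y : J y -> J (h y).
Proof.
move=> Jy; apply: orbital_trans (Jy) _; apply: (orbital_any F_base).
exact: orbital_moved Jy g0x0.
Qed.

Lemma J_lt h h' x y : h x < h' x -> J x -> J y -> h y < h' y.
Proof.
move=> lt_x Jx Jy; apply: (lt_orbital F_base (orbital_moved Jx g0x0)) lt_x.
exact: orbital_trans (orbital_sym Jx) Jy.
Qed.

Lemma J_up h x y : x < h x -> J x -> J y -> y < h y.
Proof. exact: (@J_lt 1 h x y). Qed.

Lemma J_orbital h x y : J x -> J y -> x < h x -> orbital h x y.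
Proof.
move=> Jx Jy hx; apply: (sub_orbital F_base _ (orbital_moved Jx g0x0)).
  by move=> h_x; move: hx; rewrite h_x ltxx.
exact: orbital_trans (orbital_sym Jx) Jy.
Qed.

(** The gap from [x] to [y] contains a full translation step; this will be the strict order between
    fibres. *)
Definition way_below x y := exists2 g : order_aut T, x < g x & g x <= y.
Local Notation "x <<| y" := (way_below x y) (at level 70).

Lemma way_below_lt x y : x <<| y -> x < y.
Proof. by case=> g gx; apply: lt_le_trans. Qed.

Lemma way_below_le x y z : x <<| y -> y <= z -> x <<| z.
Proof. by case=> g gx le_gy le_yz; exists g => //; apply: le_trans le_yz. Qed.

Lemma le_way_below x y z : J x -> J y -> x <= y -> y <<| z -> x <<| z.
Proof.
move=> Jx Jy le_xy [g gy le_gz]; exists g; first exact: (J_up gy).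
by apply: le_trans le_gz; rewrite order_aut_le.
Qed.

Lemma way_below_app h x y : x <<| y -> h x <<| h y.
Proof.
case=> g gx le_gy; exists (h * g * h^-1).
  by rewrite !order_autM order_autK order_aut_lt.
by rewrite !order_autM order_autK order_aut_le.
Qed.

Lemma way_below_appE h x y : h x <<| h y <-> x <<| y.
Proof.
split=> [/(way_below_app h^-1)|]; last exact: way_below_app.
by rewrite !order_autK.
Qed.

Hypothesis x0_dense :
  forall t, x0 < t x0 -> exists2 h : order_aut T, x0 < h x0 & h x0 < t x0.

Let Jx0 : J x0 := orbital_refl g0 x0.

Lemma J_dense t y : J y -> y < t y -> exists2 h : order_aut T, y < h y & h y < t y.
Proof.
move=> Jy ty; have /x0_dense := J_up ty Jy Jx0; case=> h hx0 lt_h.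
exists h; first exact: (J_up hx0).
exact: (J_lt lt_h).
Qed.

(* Either [h] or [t h^-1] works, when [h] moves [x] strictly less than [t]. *)
Lemma halve x y : J x -> x <<| y -> exists2 k : order_aut T, x < k x & k (k x) <= y.
Proof.
move=> Jx [t tx le_ty]; have [h hx lt_h] := J_dense Jx tx.
have [le_hh|lt_hh] := leP (h (h x)) (t x).
  by exists h => //; apply: le_trans le_ty.
have JVx : J (h^-1 x) by apply: J_app.
have kx : x < t (h^-1 x).
  by rewrite -{1}(order_autVK h x); apply: J_lt lt_h Jx JVx.
exists (t * h^-1) => //; apply: le_trans le_ty; apply: ltW.
rewrite !order_autM order_aut_lt -(order_aut_lt h) order_autVK.
(* Carrying [t x < h (h x)] from [x] over to [h^-1 x] gives [t (h^-1 x) < h x]. *)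
have := @J_lt t (h * h) x (h^-1 x) lt_hh Jx JVx.
by rewrite order_autM order_autVK.
Qed.

(** Halving twice leaves room: powers of [f] bring [z] between [f x] and [f (f x)], at least one
    step of [f] above [x] and, as [f] moves less than [k], one step below [y]. *)
Lemma way_below_split x y z : J x -> J y -> J z -> x <<| y ->
  exists g, x <<| g z /\ g z <<| y.
Proof.
move=> Jx Jy Jz /(halve Jx)[k kx le_k].
have [f fx le_f] : exists2 f : order_aut T, x < f x & f (f x) <= k x.
  by apply: halve => //; exists k.
have Jfx : J (f x) by apply: J_app.
have [|m [n /andP[le_g lt_g]]] := orbital_domain (J_up fx Jx Jfx) (y := z).
  exact: J_orbital (J_up fx Jx Jfx).
exists ((f ^+ n)^-1 * f ^+ m); split; first by exists f.
exists f; first by apply: (J_up fx) => //; apply: J_app.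
have lt_fk : f (k x) < k (k x).
  apply: (@J_lt _ _ x) => //; last exact: J_app.
  by apply: lt_le_trans le_f; rewrite order_aut_lt.
apply: le_trans le_k; apply: ltW; apply: lt_trans lt_fk; rewrite order_aut_lt.
exact: lt_le_trans lt_g le_f.
Qed.

(* Points that are not far apart lie in the same fibre of [J] over its
   completion by the orbit of [x0]. *)
Definition near x y := ~ (x <<| y) /\ ~ (y <<| x).

Lemma near_refl x : near x x.
Proof. by split=> /way_below_lt; rewrite ltxx. Qed.

Lemma near_sym x y : near x y -> near y x.
Proof. by case. Qed.

Lemma near_appE h x y : near (h x) (h y) <-> near x y.
Proof. by rewrite /near !way_below_appE. Qed.

Lemma near_lt k x y : x < k x -> near x y -> y < k x.
Proof.
by move=> kx [not_xy _]; rewrite ltNge; apply/negP => le_ky; apply: not_xy; exists k.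
Qed.

(** Halving provides the slack: nearness gives [y < k x], hence [k y < k (k x) <= z]. *)
Lemma near_way_below x y z : J x -> J y -> near x y -> x <<| z -> y <<| z.
Proof.
move=> Jx Jy xy /(halve Jx)[k kx le_k]; exists k; first exact: (J_up kx).
by apply: le_trans le_k; rewrite ltW // order_aut_lt near_lt.
Qed.

Lemma way_below_near x y z : J x -> J y -> J z -> near y z -> x <<| y -> x <<| z.
Proof.
move=> Jx Jy Jz [_ not_zy] /(halve Jx)[k kx le_k]; exists k => //.
rewrite leNgt; apply/negP => lt_z; apply: not_zy; exists k; first exact: (J_up kx).
by apply: le_trans le_k; rewrite ltW // order_aut_lt.
Qed.

Lemma way_below_near2 x y x' y' : J x -> J y -> J x' -> J y' ->
  near x x' -> near y y' -> x <<| y -> x' <<| y'.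
Proof.
move=> Jx Jy Jx' Jy' xx' yy' x_y.
by apply: (way_below_near Jx' Jy Jy' yy'); apply: near_way_below xx' x_y.
Qed.

(* A finite partial automorphism in which [(x, g)] makes the fibre of [x] follow
   [g]. *)
Definition piecewise (l : seq (T * order_aut T)) :=
  (forall p, p \in l -> J p.1) /\
  (forall p q, p \in l -> q \in l ->
    [\/ p = q, p.1 <<| q.1 /\ p.2 p.1 <<| q.2 q.1
      | q.1 <<| p.1 /\ q.2 q.1 <<| p.2 p.1]).

(** A finite list controls whole fibres of [J], possibly infinite, and all points outside [J] are
    fixed from the start. *)
Definition piecewise_rel (l : seq (T * order_aut T)) x y :=
  (~ J x /\ y = x) \/
  (exists p, [/\ p \in l, J x, near x p.1 & y = p.2 x]).

(** Points of one piece follow the same automorphism, and points of distinct pieces compare as their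
    base points do, before and after. A point outside the convex set [J] is on the same side of all
    of [J]. *)
Lemma piecewise_rel_mono l : piecewise l -> monotone_rel (piecewise_rel l).
Proof.
case=> Jl l_incr.
have J_out u v w : ~ J u -> J v -> J w -> (u <= v) = (u <= w).
  move=> Ju Jv Jw; apply/idP/idP => le_u; rewrite leNgt; apply/negP => /ltW lt_u; apply: Ju.
    exact: orbital_convex Jw Jv lt_u le_u.
  exact: orbital_convex Jv Jw lt_u le_u.
have J_out' u v w : ~ J u -> J v -> J w -> (v <= u) = (w <= u).
  move=> Ju Jv Jw; apply/idP/idP => le_u; rewrite leNgt; apply/negP => /ltW lt_u; apply: Ju.
    exact: orbital_convex Jv Jw le_u lt_u.
  exact: orbital_convex Jw Jv le_u lt_u.
move=> x y x' y' [[Jx ->]|[p [pl Jx xp ->]]] [[Jx' ->]|[p' [pl' Jx' xp' ->]]] //.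
- by apply: J_out => //; apply: J_app.
- by apply: J_out' => //; apply: J_app.
have Jp := Jl _ pl; have Jp' := Jl _ pl'.
have far (q r : T * order_aut T) u v : J q.1 -> J r.1 -> J u -> J v -> near u q.1 -> near v r.1 ->
    q.1 <<| r.1 /\ q.2 q.1 <<| r.2 r.1 -> u < v /\ q.2 u < r.2 v.
  move=> Jq Jr Ju Jv uq vr [q_r q2_r2]; split; apply: way_below_lt.
    by apply: way_below_near2 q_r => //; apply: near_sym.
  apply: (way_below_near2 (J_app _ Jq) (J_app _ Jr) (J_app _ Ju) (J_app _ Jv)) q2_r2.
    exact/near_appE/near_sym.
  exact/near_appE/near_sym.
have [<-|inc|inc] := l_incr p p' pl pl'; first by rewrite order_aut_le.
  by have [lt1 lt2] := far p p' x x' Jp Jp' Jx Jx' xp xp' inc; rewrite !ltW.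
have [lt1 lt2] := far p' p x' x Jp' Jp Jx' Jx xp' xp inc.
by rewrite !leNgt lt1 lt2.
Qed.

(** As [x] is near no base point, each piece is far below or far above it. The value [g x] is placed
    between the greatest image from below and the least image from above. *)
Lemma piecewise_extend l x : J x -> piecewise l ->
  (forall p, p \in l -> ~ near x p.1) -> exists g, piecewise ((x, g) :: l).
Proof.
move=> Jx [Jl l_incr] x_new.
pose L := [seq p.2 p.1 | p : T * order_aut T <- l & `[< p.1 <<| x >]].
pose U := [seq p.2 p.1 | p : T * order_aut T <- l & `[< x <<| p.1 >]].
have L_in p : p \in l -> p.1 <<| x -> p.2 p.1 \in L.
  by move=> pl px; apply/mapP; exists p; rewrite // mem_filter pl andbT; apply/asboolP.
have U_in p : p \in l -> x <<| p.1 -> p.2 p.1 \in U.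
  by move=> pl px; apply/mapP; exists p; rewrite // mem_filter pl andbT; apply/asboolP.
have JL v : v \in L -> J v.
  by case/mapP=> p; rewrite mem_filter => /andP[_ pl] ->; apply/J_app/Jl.
have JU v : v \in U -> J v.
  by case/mapP=> p; rewrite mem_filter => /andP[_ pl] ->; apply/J_app/Jl.
have LU u v : u \in L -> v \in U -> u <<| v.
  case/mapP=> p; rewrite mem_filter => /andP[/asboolP px pl] ->.
  case/mapP=> q; rewrite mem_filter => /andP[/asboolP xq ql] ->.
  have lt_pq : p.1 < q.1 by apply: lt_trans (way_below_lt px) (way_below_lt xq).
  have [eq_pq|[]//|[/way_below_lt lt_qp]] := l_incr p q pl ql.
    by move: lt_pq; rewrite eq_pq ltxx.
  by move: (lt_trans lt_pq lt_qp); rewrite ltxx.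
have [t x0t _] := moved_up g0x0.
have t_way v : J v -> v <<| t v by move=> Jv; exists t => //; apply: J_up x0t _ _.
have tV_way v : J v -> t^-1 v <<| v.
  by move=> Jv; rewrite -{2}(order_autVK t v); apply/t_way/J_app.
(* When there is no image on one side, [t] or its inverse supplies a bound. *)
have [a [b [Ja Jb ab [La Ub]]]] : exists a b, [/\ J a, J b, a <<| b &
    {in L, forall u, u <= a} /\ {in U, forall u, b <= u}].
  have [L0|[a aL a_max]] := seq_max L; have [U0|[b bU b_min]] := seq_min U.
  - by exists x0, (t x0); split; rewrite ?L0 ?U0 //; [apply: J_app | apply: t_way].
  - exists (t^-1 b), b; split; rewrite ?L0 //; [|exact: JU| exact/tV_way/JU].
    exact/J_app/JU.
  - exists a, (t a); split; rewrite ?U0 //; [exact: JL| |exact/t_way/JL].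
    exact/J_app/JL.
  - by exists a, b; split=> //; [apply: JL | apply: JU | apply: LU].
have [g [ag gb]] := way_below_split Ja Jb Jx ab.
exists g; split=> [p|p q]; first by rewrite inE => /predU1P[->|/Jl].
have new r : r \in l -> (r.1 <<| x /\ r.2 r.1 <<| g x) \/ (x <<| r.1 /\ g x <<| r.2 r.1).
  move=> rl; have [rx|not_rx] := pselect (r.1 <<| x).
    left; split=> //; have rL := L_in r rl rx.
    by apply: le_way_below ag => //; [apply: JL | apply: La].
  have [xr|not_xr] := pselect (x <<| r.1); last by case: (x_new r rl).
  right; split=> //; have rU := U_in r rl xr.
  by apply: way_below_le gb _; apply: Ub.
rewrite !inE => /predU1P[->|pl] /predU1P[->|ql].
- by constructor 1.
- by have [] := new q ql; [constructor 3 | constructor 2].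
- by have [] := new p pl; [constructor 2 | constructor 3].
- exact: l_incr.
Qed.

Lemma piecewise_rel_sub p l :
  subrel_prop (piecewise_rel l) (piecewise_rel (p :: l)).
Proof.
move=> x y [[Jx ->]|[q [ql Jx xq ->]]]; first by left.
by right; exists q; split=> //; rewrite inE ql orbT.
Qed.

Lemma piecewise_forth l x : piecewise l ->
  exists l', [/\ piecewise l', subrel_prop (piecewise_rel l) (piecewise_rel l') &
    exists y, piecewise_rel l' x y].
Proof.
move=> l_ok; have [Jx|Jx] := pselect (J x); last first.
  by exists l; split=> //; exists x; left.
have [[p pl xp]|x_new] := pselect (exists2 p, p \in l & near x p.1).
  by exists l; split=> //; exists (p.2 x); right; exists p.
have [|g l'_ok] := piecewise_extend Jx l_ok.
  by move=> p pl xp; apply: x_new; exists p.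
exists ((x, g) :: l); split=> //; first exact: piecewise_rel_sub.
exists (g x); right; exists (x, g); split=> //; first by rewrite inE eqxx.
exact: near_refl.
Qed.

(** Each base point is replaced by its image, which reduces the back step to the forth step. *)
Definition inverse_pieces (l : seq (T * order_aut T)) := [seq (p.2 p.1, p.2^-1) | p : T * order_aut T <- l].

Lemma piecewise_inverse l : piecewise l -> piecewise (inverse_pieces l).
Proof.
case=> Jl l_incr; split=> [_ /mapP[p pl ->]|]; first exact/J_app/Jl.
move=> _ _ /mapP[[x g] pl ->] /mapP[[y h] ql ->].
rewrite /fst /snd !order_autK.
by have [[-> ->]|[]|[]] := l_incr (x, g) (y, h) pl ql; [constructor 1|constructor 2|constructor 3].
Qed.

Lemma piecewise_rel_inverse l x y :
  piecewise_rel l x y -> piecewise_rel (inverse_pieces l) y x.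
Proof.
case=> [[Jx ->]|[p [pl Jx xp ->]]]; first by left.
right; exists (p.2 p.1, p.2^-1); split; last by rewrite /snd order_autK.
- by apply/mapP; exists p.
- exact: J_app.
- exact/near_appE.
Qed.

Lemma piecewise_back l y : piecewise l ->
  exists l', [/\ piecewise l', subrel_prop (piecewise_rel l) (piecewise_rel l') &
    exists x, piecewise_rel l' x y].
Proof.
move=> /piecewise_inverse/(piecewise_forth y)[l' [l'_ok sub_l' [x l'yx]]].
exists (inverse_pieces l'); split; first exact: piecewise_inverse.
  move=> u v /piecewise_rel_inverse/sub_l'/piecewise_rel_inverse //.
by exists x; apply: piecewise_rel_inverse.
Qed.

Lemma dense_orbit_false : False.
Proof.
have [t x0t _] := moved_up g0x0.
have x0_tx0 : x0 <<| t x0 by exists t.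
have x0_ttx0 : x0 <<| t (t x0) by exists t => //; rewrite order_aut_le ltW.
(* The limit will fix [x0] and yet move [t x0], against freeness on [J]. *)
pose l0 := [:: (x0, 1); (t x0, t)].
have l0_ok : piecewise l0.
  split=> [p|p q]; rewrite !inE.
    by move=> /orP[] /eqP->; [| apply: J_app].
  by move=> /orP[] /eqP-> /orP[] /eqP->; [constructor 1|constructor 2|constructor 3|constructor 1].
pose S p := exists2 l, piecewise l & p = piecewise_rel l.
have S_mono p : S p -> monotone_rel p by case=> l l_ok ->; apply: piecewise_rel_mono.
have S_forth p x : S p -> exists q, [/\ S q, subrel_prop p q & exists y, q x y].
  case=> l l_ok ->; have [l' [l'_ok sub_l' ex_y]] := piecewise_forth x l_ok.
  by exists (piecewise_rel l'); split=> //; exists l'.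
have S_back p y : S p -> exists q, [/\ S q, subrel_prop p q & exists x, q x y].
  case=> l l_ok ->; have [l' [l'_ok sub_l' ex_x]] := piecewise_back y l_ok.
  by exists (piecewise_rel l'); split=> //; exists l'.
have Sl0 : S (piecewise_rel l0) by exists l0.
have S_triv (n : nat) p : S p -> exists q, [/\ S q, subrel_prop p q & True].
  by move=> Sp; exists p; split.
have [h [h_l0 _]] := back_and_forth countable_T Sl0 S_mono S_forth S_back S_triv.
have Jt : J (t x0) by apply: J_app.
have hx0 : h x0 = x0.
  apply: h_l0; right; exists (x0, 1); split=> //; first by rewrite inE eqxx.
  exact: near_refl.
have htx0 : h (t x0) = t (t x0).
  apply: h_l0; right; exists (t x0, t); split=> //; first by rewrite !inE eqxx orbT.
  exact: near_refl.
have := fix_orbital F_base g0x0 Jt hx0.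
by rewrite htx0 => /order_aut_inj tx0; move: x0t; rewrite tx0 ltxx.
Qed.

End DenseOrbital.

(** * Integral coordinates *)

Definition expz (G : groupType) (g : G) (k : int) : G :=
  match k with Posz n => g ^+ n | Negz n => g ^- n.+1 end.

(** Writing integers as differences of naturals removes the sign cases from the addition law. *)
Lemma expzB (G : groupType) (g : G) (m n : nat) :
  expz g (m%:Z - n%:Z)%R = g ^- n * g ^+ m.
Proof.
have [le_nm|lt_mn] := leqP n m.
  have -> : (m%:Z - n%:Z)%R = (m - n)%N by lia.
  by rewrite -{2}(subnKC le_nm) expgnDr mulKg.
have -> : (m%:Z - n%:Z)%R = Negz (n - m).-1 by lia.
by rewrite -{2}(subnKC (ltnW lt_mn)) expgnDr invgM mulgVK /= prednK // subn_gt0.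
Qed.

Lemma expzD (G : groupType) (g : G) (k l : int) :
  expz g (k + l)%R = expz g k * expz g l.
Proof.
have int_subP (i : int) : exists m n : nat, i = (m%:Z - n%:Z)%R.
  by case: i => n; [exists n, 0%N | exists 0%N, n.+1]; lia.
have [m [n ->]] := int_subP k; have [p [q ->]] := int_subP l.
have -> : (m%:Z - n%:Z + (p%:Z - q%:Z) = (m + p)%N%:Z - (q + n)%N%:Z)%R by lia.
rewrite !expzB !expgnDr invgM !mulgA; congr (_ * _); rewrite -!mulgA; congr (_ * _).
by apply/commute_sym/commuteV/commuteX2.
Qed.

Section Translations.
Variables (d : Order.disp_t) (T : orderType d).
Implicit Types (f g h t : order_aut T) (x y : T).

Lemma expz_fix g x k : g x = x -> expz g k x = x.
Proof.
move=> gx; have fixX n : (g ^+ n) x = x.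
  by elim: n => // n IHn; rewrite expgS order_autM IHn.
by case: k => n /=; [apply: fixX | apply: order_aut_fixV].
Qed.

Lemma expz_lt g x k l : x < g x -> (k < l)%R -> expz g k x < expz g l x.
Proof.
move=> gx lt_kl; have -> : l = (k + `|l - k|.-1.+1)%R by lia.
rewrite expzD order_autM order_aut_lt /=.
by apply: (lt_le_trans gx); apply: (@expg_up _ _ g x 1 _ (ltW gx)).
Qed.

Lemma expz_inj g x : x < g x -> injective (fun k => expz g k x).
Proof.
move=> gx k l /= eq_kl; case: (ltgtP k l) => // /(expz_lt gx).
  by rewrite eq_kl ltxx.
by rewrite eq_kl ltxx.
Qed.

(** Powers of [t] bring [h x] into the fundamental domain from [x] to [t x], where minimality of [t]
    leaves only [x] itself. *)
Lemma minimal_translation_cyclic t h x :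
    (forall g, x < g x -> t x <= g x) -> x < t x -> orbital t x (h x) ->
  exists k, h x = expz t k x.
Proof.
move=> t_min tx /(orbital_domain tx)[m [n]].
rewrite -!order_autM -mulgA => /andP[le_u]; rewrite le_eqVlt in le_u.
case/orP: le_u => [/eqP u_x _|/t_min]; last by rewrite leNgt => /negPf->.
exists (n%:Z - m%:Z)%R; rewrite expzB [in RHS]u_x !order_autM order_autVK.
by rewrite order_autK.
Qed.

(** In a base of least size, the points other than [x i] no longer form a base, so some nontrivial
    automorphism fixes them all and must move [x i]. *)
Lemma minimal_base : countable [set: T] -> countable [set: order_aut T] ->
  exists (n : nat) (x : 'I_n -> T),
    (forall g, (forall i, g (x i) = x i) -> g = 1) /\
    (forall i, exists2 s : order_aut T, s (x i) <> x i &
       forall j, j != i -> s (x j) = x j).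
Proof.
move=> cT cAut; have [F F_base] := finite_base cT cAut.
pose base n (x : 'I_n -> T) := forall g, (forall i, g (x i) = x i) -> g = 1.
have ex_base : exists n, `[< exists y : 'I_n -> T, base n y >].
  exists (size F); apply/asboolP; exists (tnth (in_tuple F)) => g gF.
  by apply: F_base => y /(tnthP (in_tuple F))[i ->].
case: (ex_minnP ex_base) => n /asboolP[x x_base] n_min.
exists n, x; split=> // i; case: n => [|n] in x x_base n_min i *; first by case: i.
apply: contrapT => no_s; have /n_min : `[< exists y : 'I_n -> T, base n y >]; last by rewrite ltnn.
apply/asboolP; exists (x \o lift i) => g gx.
have g_fix j : j != i -> g (x j) = x j by case: (unliftP i j) => [k ->|->]; rewrite ?eqxx //= => _; apply: gx.
apply: x_base => j; have [->|/g_fix//] := eqVneq j i.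
by apply: contrapT => gxi; apply: no_s; exists g.
Qed.

End Translations.

(** * Integer coordinates along a minimal base *)

Theorem theorem3 (d : Order.disp_t) (Omega : orderType d)
    (countable_Omega : countable [set: Omega])
    (countable_Aut : countable [set: order_aut Omega]) :
  exists n : nat, free_abelian_of_rank n (order_aut Omega).
Proof.
have [n [x [x_base x_indep]]] := minimal_base countable_Omega countable_Aut.
have F_base (g : order_aut Omega) : {in codom x, forall y, g y = y} -> g = 1.
  by move=> gx; apply: x_base => i; apply/gx/codom_f.
(* The generator [t] is a least translation at [x i], cut down to its orbital so that it fixes the
   other base points. *)
have ex_t i : exists t : order_aut Omega, [/\ x i < t (x i),
    forall h : order_aut Omega, exists k, h (x i) = expz t k (x i) &
    forall j, j != i -> t (x j) = x j].
  have [s sxi sxj] := x_indep i.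
  have [t0 t0x t0_min] : exists2 t0 : order_aut Omega, x i < t0 (x i) &
      forall g : order_aut Omega, x i < g (x i) -> t0 (x i) <= g (x i).
    apply: contrapT => no_t0; apply: (dense_orbit_false F_base countable_Omega sxi).
    move=> t tx; apply: contrapT => no_h; apply: no_t0; exists t => // g gx.
    by rewrite leNgt; apply/negP => lt_g; apply: no_h; exists g.
  have t0_moved : t0 (x i) <> x i by move=> t0_x; move: t0x; rewrite t0_x ltxx.
  have tx : orbital_part t0 (x i) (x i) = t0 (x i) by apply/orbital_part_in/orbital_refl.
  exists (orbital_part t0 (x i)); split; first by rewrite tx.
    move=> h; apply: minimal_translation_cyclic; rewrite ?tx //.
    by apply: (orbital_any F_base); rewrite tx.
  (* Otherwise [x j] would be in the orbital of [s] at [x i], but [s] fixes [x j] and moves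
     [x i]. *)
  move=> j ji; apply: orbital_part_out => /(sub_orbital F_base sxi t0_moved) Oij.
  by apply: sxi; rewrite (orbital_fix (sxj j ji) (orbital_sym Oij)) sxj.
have [t t_spec] := choice ex_t.
have t_moved i : t i (x i) <> x i.
  by have [tx _ _] := t_spec i => t_x; move: tx; rewrite t_x ltxx.
have in_orbital i (h : order_aut Omega) : orbital (t i) (x i) (h (x i)).
  exact: (orbital_any F_base).
have fix_hull i (g h : order_aut Omega) : g (x i) = x i -> g (h (x i)) = h (x i).
  exact: (fix_orbital F_base (@t_moved i) (in_orbital i h)).
have ex_k (p : order_aut Omega * 'I_n) : exists k, p.1 (x p.2) = expz (t p.2) k (x p.2).
  by have [_ k_spec _] := t_spec p.2.
have [k k_spec] := choice ex_k.
have kE (g : order_aut Omega) i c : g (x i) = expz (t i) c (x i) -> k (g, i) = c.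
  by have [tx _ _] := t_spec i; rewrite (k_spec (g, i)) => /(expz_inj tx).
pose phi (g : order_aut Omega) : 'rV[int]_n := (\row_i k (g, i))%R.
exists n, phi; split.
  have phi_inj : injective phi.
    move=> g h /rowP phi_gh; apply/(mulgI h^-1); rewrite mulVg.
    apply: x_base => i; have gh : g (x i) = h (x i).
      by have := phi_gh i; rewrite !mxE (k_spec (g, i)) (k_spec (h, i)) => ->.
    by rewrite order_autM gh order_autK.
  have phi_surj v : exists g, phi g = v.
    suff [g gE] : exists g : order_aut Omega,
        forall i, g (x i) = if i \in enum 'I_n then expz (t i) (v 0%R i) (x i) else x i.
      by exists g; apply/rowP => i; rewrite mxE; apply: kE; rewrite gE mem_enum.
    (* The preimage of [v] is a product of powers of the [t a], one factor per index. Each new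
       factor fixes the other base points and, by freeness, their images under the earlier
       factors. *)
    elim: (enum 'I_n) (enum_uniq 'I_n) => [|a s IHs] /=; first by exists 1.
    case/andP=> a_s /IHs[g gE]; exists (expz (t a) (v 0%R a) * g) => i.
    rewrite order_autM gE inE; have [->|ia] := eqVneq i a; first by rewrite (negPf a_s).
    have ta_fix : expz (t a) (v 0%R a) (x i) = x i.
      by apply: expz_fix; have [_ _] := t_spec a; apply.
    by case: ifP => // _; apply: fix_hull.
  have [psi psiK] := choice phi_surj.
  by exists psi => // g; apply: phi_inj; rewrite psiK.
move=> g h; apply/rowP => i; rewrite !mxE; apply: kE.
rewrite expzD order_autM (k_spec (h, i)) /=.
(* On the orbital of [x i], [g] acts as the power of [t i] with which it agrees at [x i]; this is
   used at the point [h (x i)]. *)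
have := @fix_hull i ((expz (t i) (k (g, i)))^-1 * g) (expz (t i) (k (h, i))).
rewrite !order_autM (k_spec (g, i)) order_autK => /(_ erefl).
by move=> /(congr1 (expz (t i) (k (g, i)))); rewrite order_autVK.
Qed.
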